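(* Let $U \subset \mathbb{R}^d$ be bounded, connected and open. Let $(x_n)_{n\ge1}$ be a sequence of points of $U$ such that $\{x_n : n \ge 1\}$ is dense in $U$, and set $\Omega_n = \{x_1,\dots,x_n\}$. Let $Q \subset \mathbb{R}^d$ be bounded and, for each $n$, let $\phi_n : \Omega_n \to Q$ be weakly isotonic. Then there is a sequence $(S_n)$ of similarities of $\mathbb{R}^d$ such that, for all $h > 0$, $\max_{x \in \Omega_n \cap U^h} \|\phi_n(x) - S_n(x)\| \to 0$ as $n \to \infty$. If in fact each $\phi_n$ is isotonic, then there is a sequence $(S_n)$ of similarities such that $\max_{x\in\Omega_n}\|\phi_n(x)-S_n(x)\| \to 0$ as $n\to\infty$.
   Context: $\|\cdot\|$ is the Euclidean norm and $B(x,r)$ the open ball. A function $f : A \to \mathbb{R}^d$, $A\subset\mathbb{R}^d$, is weakly isotonic if for all $x,y,z \in A$: $\|x-y\| < \|x-z\|$ implies $\|f(x)-f(y)\| \le \|f(x)-f(z)\|$. It is isotonic if for all $x,y,x',y' \in A$: $\|x-y\| < \|x'-y'\|$ implies $\|f(x)-f(y)\| \le \|f(x')-f(y')\|$. For $V \subset \mathbb{R}^d$ and $h>0$, $V^h = \{x \in V : \exists y \in V \text{ with } x \in B(y,h) \subset V\}$. A similarity is a map $x \mapsto \lambda R(x) + b$ with $\lambda \ge 0$, $R$ orthogonal, $b \in \mathbb{R}^d$ (degenerate case $\lambda=0$ allowed). A maximum over the empty set is $0$. *)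

(* Defs.v *)
From HB Require Import structures.
From mathcomp Require Import all_boot all_order all_algebra.
From mathcomp Require Import all_classical all_reals all_analysis.

Set Implicit Arguments.
Unset Strict Implicit.
Unset Printing Implicit Defensive.

Import Order.TTheory GRing.Theory Num.Theory.
Import numFieldNormedType.Exports.

Local Open Scope classical_set_scope.
Local Open Scope ring_scope.

(* Points of R^d are row vectors 'rV[R]_d. The norm `|v| that the library
   puts on 'rV[R]_d is the sup norm, so the Euclidean norm is defined here.
   The library topology on 'rV[R]_d (the product topology) and its bounded sets
   are the Euclidean ones. *)

Definition enorm (R : realType) (d : nat) (v : 'rV[R]_d) : R :=
  Num.sqrt (\sum_(j < d) v 0 j ^+ 2).

Definition eball (R : realType) (d : nat) (c : 'rV[R]_d) (r : R) :
    set 'rV[R]_d :=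
  [set v | enorm (v - c) < r].

(* In the next two definitions f stands for a function A -> R^d; its values
   outside A are irrelevant. *)
Definition weakly_isotonic (R : realType) (d : nat) (A : set 'rV[R]_d)
    (f : 'rV[R]_d -> 'rV[R]_d) : Prop :=
  forall x y z, A x -> A y -> A z ->
    enorm (x - y) < enorm (x - z) ->
    enorm (f x - f y) <= enorm (f x - f z).

Definition isotonic (R : realType) (d : nat) (A : set 'rV[R]_d)
    (f : 'rV[R]_d -> 'rV[R]_d) : Prop :=
  forall x y x' y', A x -> A y -> A x' -> A y' ->
    enorm (x - y) < enorm (x' - y') ->
    enorm (f x - f y) <= enorm (f x' - f y').

(* V^h: the union of the open balls of radius h centred in V and included
   in V. *)
Definition ball_core (R : realType) (d : nat) (V : set 'rV[R]_d) (h : R) :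
    set 'rV[R]_d :=
  [set x | V x /\ exists y, [/\ V y, eball y h x & eball y h `<=` V]].

Definition orthogonal_matrix (R : realType) (d : nat) (M : 'M[R]_d) : Prop :=
  M *m M^T = 1%:M.

(* Vectors are rows, so the linear map of the matrix M is v |-> v *m M. The
   degenerate case lambda = 0 is allowed. *)
Definition similarity (R : realType) (d : nat)
    (S : 'rV[R]_d -> 'rV[R]_d) : Prop :=
  exists (lambda : R) (M : 'M[R]_d) (b : 'rV[R]_d),
    [/\ 0 <= lambda, orthogonal_matrix M &
        forall v, S v = lambda *: (v *m M) + b].

(* The set of the first n points of the sequence x_0, x_1, x_2, and so on:
   indices start at 0. *)
Definition sample (R : realType) (d : nat) (x : nat -> 'rV[R]_d) (n : nat) :
    set 'rV[R]_d :=
  [set x i | i in `I_n].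

(* The maximum of |f v - g v| over the v in sample x n that belong to V, and 0
   if there is none. *)
Definition max_error (R : realType) (d : nat) (x : nat -> 'rV[R]_d) (n : nat)
    (V : set 'rV[R]_d) (f g : 'rV[R]_d -> 'rV[R]_d) : R :=
  \big[Num.max/0]_(i < n | x i \in V) enorm (f (x i) - g (x i)).

(* Main.v *)
(* The sequences phi n are compared with their limits along an ultrafilter on
   the indices. If the claim failed for some tolerance, take an ultrafilter G of
   bad indices. Replacing each z in U by its nearest sample points, the limit of
   phi n along G defines a bounded weakly isotonic F on all of U.

   Such an F is a similarity. It is continuous: a jump at x would spread to all
   points near x and give infinitely many separated values. Hence equal distances
   from a common point go to equal distances, so the images of the 2d ends of an
   orthonormal cross centred at m satisfy enough orthogonality relations for
   dimension d to force F to preserve the midpoint m. Midpoint preservation and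
   boundedness make F affine, and then a similarity, on small balls; connectedness
   glues the balls.

   Finally let F = S on U, and let bad points p n converge to z and phi n (p n)
   to w along G. Weak isotonicity at y close to z bounds |S y - w| by |S y - S u|
   with u only slightly farther from y than z is, so w = S z, contradicting
   badness. Such y and u exist when z is in a closed ball whose interior lies in
   U; in the isotonic case |S y - w| can be compared with |S u - S v| for
   arbitrary u, v in U, and any z in the closure of U will do. *)

Require Import Defs.
From HB Require Import structures.
From mathcomp Require Import all_boot all_order all_algebra.
From mathcomp Require Import all_classical all_reals all_analysis.
From mathcomp Require Import ring lra.

Set Implicit Arguments.
Unset Strict Implicit.
Unset Printing Implicit Defensive.

Import Order.TTheory GRing.Theory Num.Theory.
Import numFieldNormedType.Exports.

Local Open Scope classical_set_scope.
Local Open Scope ring_scope.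

(** * Euclidean norm and ultrafilter limits *)

Section EuclideanNorm.
Context {R : realType} {d : nat}.
Implicit Types (u v w x y z : 'rV[R]_d) (a r : R).

Definition dot u v : R := \sum_(j < d) u 0 j * v 0 j.

Lemma dotC u v : dot u v = dot v u.
Proof. by apply: eq_bigr => j _; rewrite mulrC. Qed.

Lemma dotDl u v w : dot (u + v) w = dot u w + dot v w.
Proof. by rewrite -big_split; apply: eq_bigr => j _; rewrite mxE mulrDl. Qed.

Lemma dotZl a u v : dot (a *: u) v = a * dot u v.
Proof. by rewrite mulr_sumr; apply: eq_bigr => j _; rewrite mxE mulrA. Qed.

Lemma dotNl u v : dot (- u) v = - dot u v.
Proof. by rewrite -scaleN1r dotZl mulN1r. Qed.

Lemma dotDr u v w : dot u (v + w) = dot u v + dot u w.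
Proof. by rewrite !(dotC u) dotDl. Qed.

Lemma dotZr a u v : dot u (a *: v) = a * dot u v.
Proof. by rewrite !(dotC u) dotZl. Qed.

Lemma dotNr u v : dot u (- v) = - dot u v.
Proof. by rewrite !(dotC u) dotNl. Qed.

Definition dotE := (dotDl, dotDr, dotNl, dotNr, dotZl, dotZr).

Lemma dot_ge0 v : 0 <= dot v v.
Proof. by apply: sumr_ge0 => j _; rewrite -expr2 sqr_ge0. Qed.

Lemma dot_eq0 v : (dot v v == 0) = (v == 0).
Proof.
apply/idP/eqP => [|->]; last first.
  by rewrite /dot big1 // => j _; rewrite mxE mul0r.
rewrite psumr_eq0 => [/allP v0|j _]; last by rewrite -expr2 sqr_ge0.
apply/rowP => j; have := v0 j; rewrite mem_index_enum mxE -expr2 sqrf_eq0.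
by move=> /(_ isT)/eqP.
Qed.

Lemma dot0l v : dot 0 v = 0.
Proof. by rewrite -(scale0r 0) dotZl mul0r. Qed.

Lemma dot_mulmx u v : (u *m v^T) 0 0 = dot u v.
Proof. by rewrite mxE; apply: eq_bigr => j _; rewrite mxE. Qed.

Lemma enormE v : enorm v = Num.sqrt (dot v v).
Proof. by congr Num.sqrt; apply: eq_bigr => j _; rewrite expr2. Qed.

Lemma enorm_ge0 v : 0 <= enorm v.
Proof. exact: sqrtr_ge0. Qed.

Lemma sqr_enorm v : enorm v ^+ 2 = dot v v.
Proof. by rewrite enormE sqr_sqrtr // dot_ge0. Qed.

Lemma enorm_eq0 v : (enorm v == 0) = (v == 0).
Proof. by rewrite -dot_eq0 -sqr_enorm sqrf_eq0. Qed.

Lemma enorm0 : enorm (0 : 'rV[R]_d) = 0.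
Proof. by apply/eqP; rewrite enorm_eq0. Qed.

Lemma enorm_gt0 v : (0 < enorm v) = (v != 0).
Proof. by rewrite lt_def enorm_ge0 enorm_eq0 andbT. Qed.

Lemma enormZ a v : enorm (a *: v) = `|a| * enorm v.
Proof. by rewrite !enormE !dotE mulrA -expr2 sqrtrM ?sqr_ge0 // sqrtr_sqr. Qed.

Lemma enormN v : enorm (- v) = enorm v.
Proof. by rewrite !enormE !dotE opprK. Qed.

Lemma enormB u v : enorm (u - v) = enorm (v - u).
Proof. by rewrite -enormN opprB. Qed.

Lemma ler_enorm u v : (enorm u <= enorm v) = (dot u u <= dot v v).
Proof. by rewrite !enormE ler_psqrt ?nnegrE ?dot_ge0. Qed.

Lemma dot_le_enorm u v : dot u v <= enorm u * enorm v.
Proof.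
have [->|u0] := eqVneq u 0; first by rewrite dot0l enorm0 mul0r.
have [->|v0] := eqVneq v 0; first by rewrite dotC dot0l enorm0 mulr0.
have a0 : 0 < enorm u by rewrite enorm_gt0.
have b0 : 0 < enorm v by rewrite enorm_gt0.
have := dot_ge0 (enorm v *: u - enorm u *: v); rewrite !dotE -!sqr_enorm.
rewrite (dotC v u) => h.
have {h} : 0 <= (enorm u * enorm v) * (2 * (enorm u * enorm v - dot u v)) by lra.
by rewrite pmulr_rge0 ?mulr_gt0 // pmulr_rge0 // subr_ge0.
Qed.

Lemma ler_enormD u v : enorm (u + v) <= enorm u + enorm v.
Proof.
rewrite -(@ler_pXn2r _ 2) ?nnegrE ?addr_ge0 ?enorm_ge0 // sqrrD !sqr_enorm !dotE.
have := dot_le_enorm u v; rewrite (dotC v u); lra.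
Qed.

Lemma enorm_triangle y x z : enorm (x - z) <= enorm (x - y) + enorm (y - z).
Proof. by rewrite (le_trans _ (ler_enormD _ _)) // addrA subrK. Qed.

Lemma normr_le_enorm v : `|v| <= enorm v.
Proof.
rewrite [`|v|]/Num.norm /= mx_normrE; apply/bigmax_leP; split=> [|[i j] _] /=.
  exact: enorm_ge0.
rewrite ord1 -sqrtr_sqr ler_wsqrtr // (bigD1 j) //= lerDl.
by apply: sumr_ge0 => k _; rewrite sqr_ge0.
Qed.

Lemma enorm_le_normr v : enorm v <= d%:R * `|v|.
Proof.
have hv j : `|v 0 j| <= `|v|.
  rewrite [`|v|]/Num.norm /= mx_normrE; apply/bigmax_geP; right.
  by exists (0, j).
have [d0|d0] := posnP d.
  suff -> : v = 0 by rewrite enorm0 mulr_ge0.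
  by apply/rowP => -[j jd]; exfalso; rewrite d0 in jd.
rewrite -(@ler_pXn2r _ 2) ?nnegrE ?mulr_ge0 ?enorm_ge0 // sqr_enorm exprMn.
apply: (@le_trans _ _ (\sum_(j < d) `|v| ^+ 2)).
  apply: ler_sum => j _; rewrite -expr2 -real_normK ?num_real //.
  by rewrite ler_pXn2r ?nnegrE.
rewrite sumr_const card_ord -[leLHS]mulr_natl ler_wpM2r ?sqr_ge0 //.
by rewrite -natrX ler_nat leq_pmulr.
Qed.

Lemma open_eball (U : set 'rV[R]_d) x : open U -> U x ->
  exists2 r, 0 < r & eball x r `<=` U.
Proof.
rewrite openE => /[apply] /nbhs_ballP[r /= r0 rU]; exists r => // y yr.
apply: rU; rewrite mx_norm_ball /ball_ /= distrC.
exact: le_lt_trans (normr_le_enorm _) yr.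
Qed.

Lemma eball_open (U : set 'rV[R]_d) :
  (forall x, U x -> exists2 r, 0 < r & eball x r `<=` U) -> open U.
Proof.
move=> HU; rewrite openE => x /HU[r r0 rU]; apply/nbhs_ballP.
have d0 : 0 < d.+1%:R :> R by rewrite ltr0n.
exists (r / d.+1%:R) => /=; first exact: divr_gt0.
move=> y; rewrite mx_norm_ball /ball_ /= distrC => yr; apply: rU => /=.
apply: le_lt_trans (enorm_le_normr _) _.
apply: (@le_lt_trans _ _ (d.+1%:R * `|y - x|)).
  by rewrite ler_wpM2r // ler_nat.
by rewrite mulrC -ltr_pdivlMr.
Qed.

Lemma nbhs_eball x r : 0 < r -> nbhs x (eball x r).
Proof.
move=> r0; apply: open_nbhs_nbhs; split; last by rewrite /eball /= subrr enorm0.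
apply: eball_open => y /= yr; exists (r - enorm (y - x)); first by rewrite subr_gt0.
move=> z /= zy; apply: le_lt_trans (enorm_triangle y _ _) _.
by rewrite -ltrBrDr.
Qed.

Lemma closure_eball (A : set 'rV[R]_d) x r : closure A x -> 0 < r ->
  exists2 y, A y & enorm (y - x) < r.
Proof. by move=> Ax /(nbhs_eball x)/Ax[y [Ay yr]]; exists y. Qed.

Lemma bounded_enorm (Q : set 'rV[R]_d) : bounded_set Q ->
  exists K, forall v, Q v -> enorm v <= K.
Proof.
move=> [K [_ HK]]; exists (d%:R * (`|K| + 1)) => v Qv.
apply: le_trans (enorm_le_normr _) _; rewrite ler_wpM2l //.
by apply: HK => //; rewrite (le_lt_trans (ler_norm _)) // ltrDl.
Qed.

Definition ecvg_along (F : set_system nat) (u : nat -> 'rV[R]_d) v :=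
  forall r, 0 < r -> F [set n | enorm (u n - v) < r].

(** The image of [F] under [u] is an ultrafilter containing a bounded set, whose closure is
    compact. *)
Lemma ultra_bounded_ecvg (F : set_system nat) (u : nat -> 'rV[R]_d) K :
  UltraFilter F -> F [set n | enorm (u n) <= K] -> exists v, ecvg_along F u v.
Proof.
move=> FU uK.
have FuU : UltraFilter (u @ F).
  split; first exact: fmap_proper_filter.
  move=> G GF FG; apply/seteqP; split=> [A GA|]; last exact: FG.
  have [//|FnA] := in_ultra_setVsetC (u @^-1` A) FU.
  have : G (~` A) by apply: FG.
  by move=> GnA; have [x []] := filter_ex (filterI GA GnA).
have Kc : compact (closure [set v : 'rV[R]_d | enorm v <= K]).
  apply: bounded_closed_compact; last by apply: closed_closure.
  exists (K + 1); split; first exact: num_real.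
  move=> M KM v vc; have [w /= wK wv] := closure_eball vc ltr01.
  apply: le_trans (normr_le_enorm v) _; rewrite -[v]subr0.
  apply: le_trans (enorm_triangle w _ _) _; rewrite subr0 enormB; lra.
have uKc : (u @ F) (closure [set v : 'rV[R]_d | enorm v <= K]).
  exact: filterS (@subset_closure _ [set v : 'rV[R]_d | enorm v <= K]) uK.
rewrite compact_ultra in Kc.
have [v [_ uv]] := Kc _ FuU uKc.
by exists v => r /(nbhs_eball v)/uv.
Qed.

End EuclideanNorm.

(** * Orthonormal frames and radial linear maps *)

Section LinearAlgebra.
Context {R : realType} {d : nat}.
Implicit Types (u v w : 'rV[R]_d) (e : 'I_d -> 'rV[R]_d).

Definition orthonormal_frame e : Prop :=
  forall i j, dot (e i) (e j) = (i == j)%:R.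

Lemma dot_delta v i : dot v (delta_mx 0 i) = v 0 i.
Proof.
rewrite /dot (bigD1 i) //= big1 => [|j /negPf ji]; rewrite mxE eqxx.
  by rewrite eqxx mulr1 addr0.
by rewrite ji mulr0.
Qed.

Lemma delta_frame : orthonormal_frame (fun i => delta_mx 0 i).
Proof. by move=> i j; rewrite dot_delta mxE eqxx eq_sym. Qed.

Lemma dot_rows (A B : 'M[R]_d) i j : (A *m B^T) i j = dot (row i A) (row j B).
Proof. by rewrite mxE; apply: eq_bigr => k _; rewrite !mxE. Qed.

(** The Gram matrix of the family is diagonal and invertible, so these [d] vectors span the whole
    space. *)
Lemma orthogonal_family_total (f : 'I_d -> 'rV[R]_d) (s : 'rV[R]_d) :
    (forall i j, i != j -> dot (f i) (f j) = 0) -> (forall i, f i != 0) ->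
  (forall i, dot s (f i) = 0) -> s = 0.
Proof.
move=> f_orth f_neq0 s_orth.
pose D := \matrix_i f i.
have DU : D^T \in unitmx.
  suff: D *m D^T \in unitmx by rewrite unitmx_mul => /andP[].
  have -> : D *m D^T = diag_mx (\row_i dot (f i) (f i)).
    apply/matrixP => i j; rewrite dot_rows !rowK !mxE.
    by have [->|/f_orth ->] := eqVneq i j; rewrite ?mulr1n ?mulr0n.
  rewrite unitmxE det_diag unitfE; apply/prodf_neq0 => i _.
  by rewrite mxE dot_eq0.
rewrite -[s](mulmxK DU); suff -> : s *m D^T = 0 by rewrite mul0mx.
apply/rowP => i; rewrite !mxE -[RHS](s_orth i); apply: eq_bigr => k _.
by rewrite !mxE.
Qed.

(* Householder reflection sending a basis vector to the direction of v. *)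
Lemma frame_direction v : v != 0 ->
  exists e i, orthonormal_frame e /\ v = enorm v *: e i.
Proof.
move=> v0; have a0 : enorm v != 0 by rewrite enorm_eq0.
have [i _] : exists i, v 0 i != 0.
  apply/existsP; apply: contraNT v0; rewrite negb_exists => /forallP v0.
  by apply/eqP/rowP => i; rewrite mxE; apply/eqP; have := v0 i; rewrite negbK.
pose b : 'rV[R]_d := delta_mx 0 i.
have [u uE] : exists u, u = (enorm v)^-1 *: v by exists ((enorm v)^-1 *: v).
have [w wE] : exists w, w = u - b by exists (u - b).
have vu : v = enorm v *: u by rewrite uE scalerA divff // scale1r.
have uu : dot u u = 1.
  by rewrite uE !dotE -sqr_enorm expr2 mulKf ?mulVf.
have bb : dot b b = 1 by rewrite delta_frame eqxx.
have [w0|w0] := eqVneq w 0.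
  exists (fun i => delta_mx 0 i), i; split; first exact: delta_frame.
  by rewrite [LHS]vu (subr0_eq (etrans (esym wE) w0)).
have ww0 : dot w w != 0 by rewrite dot_eq0.
pose e j := delta_mx 0 j - (2 * w 0 j / dot w w) *: w.
exists e, i; split=> [j k|].
  rewrite /e !dotE delta_frame (dotC (delta_mx 0 j)) !dot_delta.
  by field.
rewrite {1}vu; congr (_ *: _); rewrite /e -dot_delta -/b.
have -> : 2 * dot w b / dot w w = - 1.
  have e1 : dot w w = 2 - 2 * dot u b.
    by rewrite wE !dotE uu bb (dotC b); ring.
  have e2 : dot w b = dot u b - 1 by rewrite wE !dotE bb.
  move: ww0; rewrite e1 e2 => h; field; exact: h.
by rewrite scaleN1r opprK wE addrC subrK.
Qed.

Lemma radial_similarity (A : 'M[R]_d) s : 0 < s ->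
    (forall u v, enorm u = enorm v -> enorm v < s ->
      enorm (u *m A) = enorm (v *m A)) ->
  exists (l : R) (M : 'M[R]_d), [/\ 0 <= l, orthogonal_matrix M & A = l *: M].
Proof.
move=> s0 As.
have {s s0}As u v : enorm u = enorm v -> enorm (u *m A) = enorm (v *m A).
  move=> uv; pose t := s / (enorm v + 1).
  have v0 : 0 < enorm v + 1 by rewrite ltr_wpDl ?enorm_ge0.
  have t0 : 0 < t by rewrite divr_gt0.
  have := As (t *: u) (t *: v); rewrite !enormZ uv -!scalemxAl !enormZ gtr0_norm //.
  move=> /(_ erefl) H; apply: (mulfI (lt0r_neq0 t0)); apply: H.
  by rewrite /t mulrAC ltr_pdivrMr // ltr_pM2l // ltrDl.
have rowA i : row i A = delta_mx 0 i *m A by rewrite rowE.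
have delta1 i : enorm (delta_mx 0 i : 'rV[R]_d) = 1.
  by rewrite enormE delta_frame eqxx sqrtr1.
have [[i0 _]|noi] := pselect (exists i : 'I_d, True); last first.
  exists 1, 1%:M; split=> //; first by rewrite /orthogonal_matrix trmx1 mulmx1.
  by apply/matrixP => i; case: noi; exists i.
pose l := enorm (row i0 A).
have Al i : enorm (row i A) = l.
  by rewrite /l !rowA; apply: As; rewrite !delta1.
have AA i j : dot (row i A) (row j A) = l ^+ 2 *+ (i == j).
  have [->|ij] := eqVneq i j; first by rewrite -sqr_enorm Al.
  have : enorm (delta_mx 0 i - delta_mx 0 j : 'rV[R]_d)
       = enorm (delta_mx 0 i + delta_mx 0 j : 'rV[R]_d).
    rewrite !enormE !dotE !delta_frame (eq_sym j i) (negPf ij) !eqxx /=.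
    by congr Num.sqrt; ring.
  move=> /As/(congr1 (fun x => x ^+ 2)); rewrite !sqr_enorm mulmxBl mulmxDl.
  rewrite -!rowA !dotE (dotC (row j A) (row i A)) mulr0n; lra.
have [l0|l0] := eqVneq l 0.
  exists 0, 1%:M; split=> //; first by rewrite /orthogonal_matrix trmx1 mulmx1.
  apply/row_matrixP => i; rewrite scale0r row0; apply/eqP.
  by rewrite -enorm_eq0 Al l0.
exists l, (l^-1 *: A); split; first exact: enorm_ge0.
  apply/matrixP => i j; rewrite dot_rows !linearZ /= !dotE AA mxE.
  by case: (i == j); rewrite ?mulr1n ?mulr0n; field.
by rewrite scalerA divff // scale1r.
Qed.

End LinearAlgebra.

(** * Bounded midpoint-preserving maps *)

Section MidpointAffine.
Context {R : realType} {d : nat}.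
Variables (f : 'rV[R]_d -> 'rV[R]_d) (s K : R).
Implicit Types (u v : 'rV[R]_d) (t : R).
Hypothesis s_gt0 : 0 < s.
Hypothesis f0 : f 0 = 0.
Hypothesis f_bounded : forall v, enorm v < s -> enorm (f v) <= K.
Hypothesis f_midpoint : forall u v, enorm u < s -> enorm v < s ->
  f (2^-1 *: (u + v)) = 2^-1 *: (f u + f v).

Let f_half v : enorm v < s -> f (2^-1 *: v) = 2^-1 *: f v.
Proof.
move=> vs; have := f_midpoint vs; move=> /(_ 0).
by rewrite !addr0 f0 addr0 enorm0; apply.
Qed.

Let fD u v : enorm u < s -> enorm v < s -> enorm (u + v) < s ->
  f (u + v) = f u + f v.
Proof.
move=> us vs uvs; apply: (scalerI (a := 2^-1)); first by rewrite invr_eq0 pnatr_eq0.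
by rewrite -f_half // f_midpoint.
Qed.

Let geometric_eq0 (a c : R) : 0 <= a -> (forall n, a <= c / 2 ^+ n) -> a = 0.
Proof.
move=> a0 ac; apply/eqP; rewrite eq_le a0 andbT leNgt; apply/negP => a1.
have c0 : 0 <= c / a by rewrite divr_ge0 // -[c]divr1 -(expr0 2) (le_trans a0).
have := archi_boundP c0; rewrite ltr_pdivrMr // ltNge => /negP; apply.
have := ac (Num.bound (c / a)); rewrite ler_pdivlMr ?exprn_gt0 // => /(le_trans _) -> //.
by rewrite mulrC ler_pM2l // -natrX ler_nat ltnW // ltn_expl.
Qed.

(** The defect [h] is additive, bounded, and zero at 1. Halving the argument halves [h], and
    [h a = - h (1 - a)] brings every [a] into the lower half, so the bound can be halved forever. *)
Let fZ01 v t : enorm v < s -> 0 <= t <= 1 -> f (t *: v) = t *: f v.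
Proof.
move=> vs t01; pose h a := f (a *: v) - a *: f v.
have K0 : 0 <= K by apply: le_trans (f_bounded vs); exact: enorm_ge0.
have tv (a : R) : 0 <= a <= 1 -> enorm (a *: v) < s.
  move=> /andP[a0 a1]; rewrite enormZ ger0_norm // (le_lt_trans _ vs) //.
  by rewrite ler_piMl ?enorm_ge0.
have hD (a b : R) : 0 <= a -> 0 <= b -> a + b <= 1 -> h (a + b) = h a + h b.
  move=> a0 b0 ab1; have fab : f ((a + b) *: v) = f (a *: v) + f (b *: v).
    by rewrite scalerDl fD -?scalerDl //; apply: tv; lra.
  by rewrite /h fab scalerDl opprD addrACA.
have h1 : h 1 = 0 by rewrite /h !scale1r subrr.
have hn n : forall a, 0 <= a <= 1 -> enorm (h a) <= (2 * K) / 2 ^+ n.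
  elim: n => [|n IHn] a a01.
    rewrite divr1; apply: le_trans (ler_enormD _ _) _.
    rewrite enormN enormZ ger0_norm; last lra.
    have := f_bounded (tv _ a01); have := f_bounded vs; have := enorm_ge0 (f v).
    nra.
  have half b : 0 <= b <= 2^-1 -> enorm (h b) <= 2 * K / 2 ^+ n.+1.
    move=> b01; have := IHn (b + b); rewrite hD; try lra.
    rewrite -[h b + h b]mulr2n -scaler_nat enormZ ger0_norm // exprS invfM.
    move=> H; rewrite mulrCA -ler_pdivrMl ?invr_gt0 // invrK; apply: H; lra.
  have [ha|ha] := leP a 2^-1; first by apply: half; lra.
  have -> : h a = - h (1 - a).
    by apply/eqP; rewrite -addr_eq0 -hD ?subrKC ?h1 //; lra.
  by rewrite enormN; apply: half; lra.
apply/eqP; rewrite -subr_eq0 -enorm_eq0 -/(h t); apply/eqP.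
by apply: (geometric_eq0 (c := 2 * K)) => [|n]; [exact: enorm_ge0 | exact: hn].
Qed.

Let fN v : enorm v < s -> f (- v) = - f v.
Proof.
move=> vs; apply/eqP; rewrite -addr_eq0 -fD ?enormN ?addNr ?enorm0 //.
by rewrite f0.
Qed.

Let fZ v t : enorm v < s -> enorm (t *: v) < s -> f (t *: v) = t *: f v.
Proof.
wlog t0 : t / 0 <= t => [H vs tvs|].
  have [t0|t0] := leP 0 t; first exact: H.
  have tvs' : enorm (- t *: v) < s by rewrite scaleNr enormN.
  by rewrite -[t]opprK !(scaleNr (- t)) fN // H // oppr_ge0 ltW.
move=> vs tvs; have [t1|t1] := leP t 1; first by rewrite fZ01 // t0.
have tn0 : t != 0 by rewrite gt_eqF // (lt_trans ltr01).
have t01 : 0 <= t^-1 <= 1.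
  by rewrite invr_ge0 t0 invf_le1 ?(lt_trans ltr01) // ltW.
have := fZ01 tvs t01; rewrite scalerA mulVf // scale1r => ->.
by rewrite scalerA divff // scale1r.
Qed.

Lemma midpoint_linear : exists A : 'M[R]_d, forall v, enorm v < s -> f v = v *m A.
Proof.
pose e i : 'rV[R]_d := (s / 2) *: delta_mx 0 i.
have es i : enorm (e i) < s.
  by rewrite enormZ enormE delta_frame eqxx sqrtr1 mulr1 gtr0_norm; move: s_gt0; lra.
pose A : 'M[R]_d := \matrix_i ((s / 2)^-1 *: f (e i)); exists A.
have s2 : s / 2 != 0 by rewrite gt_eqF // divr_gt0.
have fcoord i a : enorm (a *: delta_mx 0 i : 'rV[R]_d) < s ->
    f (a *: delta_mx 0 i) = (a *: delta_mx 0 i) *m A.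
  have aE : a *: delta_mx 0 i = (a / (s / 2)) *: e i by rewrite scalerA divfK.
  move=> as_; rewrite -scalemxAl -rowE rowK scalerA aE fZ //.
  by rewrite -aE.
(* Induction on the number of leading coordinates that may be nonzero. Neither the component [u]
   along axis [k] nor [v - u] is longer than [v], so additivity inside the ball applies. *)
suff H k : forall v, enorm v < s -> (forall j : 'I_d, (k <= j)%N -> v 0 j = 0) ->
    f v = v *m A.
  by move=> v vs; apply: (H d) => // j; rewrite leqNgt ltn_ord.
elim: k => [|k IHk] v vs vk.
  by have -> : v = 0 by [apply/rowP => j; rewrite mxE vk]; rewrite mul0mx.
have [dk|kd] := leqP d k.
  by apply: IHk => // j kj; have := leq_trans dk kj; rewrite leqNgt ltn_ord.
pose i := Ordinal kd.
have [u uvi] : exists u : 'rV[R]_d, u = v 0 i *: delta_mx 0 i.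
  by exists (v 0 i *: delta_mx 0 i).
have uE : dot v u = v 0 i ^+ 2 by rewrite uvi dotZr dot_delta expr2.
have uu : dot u u = v 0 i ^+ 2.
  by rewrite uvi dotZl dotZr delta_frame eqxx mulr1 expr2.
have us : enorm u < s.
  apply: le_lt_trans vs; rewrite ler_enorm uu -uE.
  have := dot_ge0 (v - u); rewrite !dotE (dotC u v) uu uE; lra.
have vus : enorm (v - u) < s.
  apply: le_lt_trans vs; rewrite ler_enorm !dotE (dotC u v) uu uE.
  have := sqr_ge0 (v 0 i); lra.
transitivity (f (v - u) + f u); first by rewrite -fD ?subrK.
rewrite -[in RHS](subrK u v) mulmxDl uvi fcoord -?uvi // IHk // => j kj.
rewrite uvi !mxE eqxx /=; have [->|ji] := eqVneq j i; first by rewrite mulr1 subrr.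
rewrite mulr0 subr0; apply: vk; rewrite ltn_neqAle kj andbT.
by apply: contraNneq ji => kj'; apply/eqP/val_inj.
Qed.

End MidpointAffine.

(** * Bounded weakly isotonic maps on an open set *)

(** [B] meets every tail, so the tail filter restricted to [B] is proper and extends to an
    ultrafilter. *)
Lemma ultra_infty_ex (B : set nat) :
  (forall N, exists2 n, (N <= n)%N & B n) ->
  exists G : set_system nat, [/\ UltraFilter G, \oo `<=` G & G B].
Proof.
move=> HB; have BF : ProperFilter (within B \oo).
  apply: Build_ProperFilter => -[N _ NA].
  by have [n Nn /(NA n Nn)] := HB N.
have [G [GU BG]] := ultraFilterLemma BF.
exists G; split=> //; last by apply: BG; apply: withinT.
by move=> A [N _ NA]; apply: BG; exists N => // n Nn _; exact: NA.
Qed.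

Section WeaklyIsotonic.
Context {R : realType} {d : nat}.
Variables (U : set 'rV[R]_d) (F : 'rV[R]_d -> 'rV[R]_d) (K : R).
Hypothesis U_open : open U.
Hypothesis F_weak : weakly_isotonic U F.
Hypothesis F_bounded : forall v, U v -> enorm (F v) <= K.
Implicit Types (u v w x y z m : 'rV[R]_d) (r e : R).

(** Two terms close to a limit along an ultrafilter are close to each other; tails belong to the
    ultrafilter, so the second index can be taken larger. *)
Lemma bounded_not_separated (u : nat -> 'rV[R]_d) e : 0 < e ->
  (forall n, enorm (u n) <= K) ->
  exists k l, (k < l)%N /\ enorm (u l - u k) < e.
Proof.
move=> e0 uK.
have [|G [GU infG _]] := @ultra_infty_ex setT; first by move=> N; exists N.
have [v uv] : exists v, ecvg_along G u v.
  apply: ultra_bounded_ecvg; apply: filterS filterT => n _; exact: uK.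
have e2 : 0 < e / 2 by rewrite divr_gt0.
have Gv := uv _ e2.
have [k /= kv] := filter_ex Gv.
have Gk : G [set n | (k < n)%N] by apply: infG; exists k.+1.
have [l [/= lv kl]] := filter_ex (filterI Gv Gk).
exists k, l; split=> //; apply: le_lt_trans (enorm_triangle v _ _) _.
by rewrite (enormB v); lra.
Qed.

(* At a discontinuity x every z != x has |F z - F x| >= e, so the images of
   points converging geometrically to x are e-separated. *)
Lemma weakly_isotonic_continuous x e : U x -> 0 < e ->
  exists2 r, 0 < r & forall y, U y -> enorm (y - x) < r -> enorm (F y - F x) < e.
Proof.
move=> Ux e0; apply: contrapT => ncont.
have jump r : 0 < r -> exists y, [/\ U y, enorm (y - x) < r & e <= enorm (F y - F x)].
  move=> r0; apply: contrapT => nex; apply: ncont; exists r => // y Uy yr.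
  by rewrite ltNge; apply/negP => ey; apply: nex; exists y.
have far z : U z -> z != x -> e <= enorm (F z - F x).
  rewrite -subr_eq0 -enorm_gt0 => Uz /jump[y [Uy yz ey]].
  apply: (le_trans ey); rewrite !(enormB _ (F x)).
  by apply: F_weak => //; rewrite !(enormB x).
have [s s0 sU] := open_eball U_open Ux.
have [y [Uy ys ey]] := jump s s0.
have yx : 0 < enorm (y - x).
  rewrite enorm_gt0 subr_eq0; apply/eqP => yx.
  by move: ey; rewrite yx subrr enorm0 leNgt e0.
(* With ratio 1/3, for [k < l] the point [z l] is strictly closer to [x] than to [z k], since
   [t k - t l >= 2 * t l]. Weak isotonicity at [z l] then separates the images. *)
pose t k : R := 3 ^- k; pose z k := x + t k *: (y - x).
have t0 k : 0 < t k by rewrite invr_gt0 exprn_gt0.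
have t1 k : t k <= 1 by rewrite invf_le1 ?exprn_gt0 // exprn_ege1 ?ler1n.
have zx k : enorm (z k - x) = t k * enorm (y - x).
  by rewrite /z addrC addKr enormZ gtr0_norm.
have Uz k : U (z k).
  apply: sU; rewrite /eball /= zx (le_lt_trans _ ys) //.
  by rewrite ler_piMl ?enorm_ge0.
have zz k l : enorm (z l - z k) = `|t l - t k| * enorm (y - x).
  by rewrite /z opprD addrACA subrr add0r -scalerBl enormZ.
have [k [l [kl]]] :=
  bounded_not_separated (u := F \o z) e0 (fun n => F_bounded (Uz n)).
apply/negP; rewrite -leNgt /=.
have zlx : z l != x by rewrite -subr_eq0 -enorm_gt0 zx mulr_gt0.
apply: (le_trans (far _ (Uz l) zlx)); apply: F_weak => //.
rewrite zx zz ltr_pM2r // distrC (lt_le_trans _ (ler_norm _)) //.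
rewrite ltrBrDr; have tl : t l.-1 = 3 * t l.
  by rewrite /t -{2}(prednK (leq_ltn_trans (leq0n k) kl)) exprS invfM mulVKf.
have tk : t l.-1 <= t k.
  rewrite /t lef_pV2 ?posrE ?exprn_gt0 // ler_eXn2l ?ltr1n //.
  by rewrite -ltnS (prednK (leq_ltn_trans (leq0n k) kl)).
by have := t0 l; lra.
Qed.

(** Pushing [z] slightly away from [x] makes the inequality strict; continuity at [z] absorbs the
    change in [F z]. *)
Lemma weakly_isotonic_le x y z : U x -> U y -> U z ->
  enorm (x - y) <= enorm (x - z) -> enorm (F x - F y) <= enorm (F x - F z).
Proof.
move=> Ux Uy Uz xyz.
have [zx|zx] := eqVneq z x.
  move: xyz; rewrite zx subrr enorm0 => yx.
  have -> : y = x; last by [].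
  by apply/esym/eqP; rewrite -subr_eq0 -enorm_eq0 eq_le yx enorm_ge0.
apply/ler_addgt0Pr => e e0.
have [r r0 rF] := weakly_isotonic_continuous Uz e0.
have [s s0 sU] := open_eball U_open Uz.
have a0 : 0 < enorm (z - x) by rewrite enorm_gt0 subr_eq0.
pose t := Num.min r s / 2 / enorm (z - x).
have t0 : 0 < t by rewrite !divr_gt0 // lt_min r0.
pose z' := z + t *: (z - x).
have zz' : enorm (z' - z) = Num.min r s / 2.
  by rewrite /z' addrC addKr enormZ gtr0_norm // divfK // gt_eqF.
have zr : enorm (z' - z) < r.
  by rewrite zz' ltr_pdivrMr // gt_min; apply/orP; left; lra.
have zs : enorm (z' - z) < s.
  by rewrite zz' ltr_pdivrMr // gt_min; apply/orP; right; lra.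
have Uz' := sU _ zs.
apply: (@le_trans _ _ (enorm (F x - F z'))).
  apply: F_weak => //; apply: le_lt_trans xyz _.
  have -> : x - z' = - ((1 + t) *: (z - x)).
    by rewrite /z' opprD addrA scalerDl scale1r opprD opprB.
  rewrite enormN enormZ gtr0_norm ?addr_gt0 // enormB.
  by rewrite ltr_pMl // ltrDl.
apply: le_trans (enorm_triangle (F z) _ _) _; rewrite lerD2l enormB.
exact: ltW (rF _ Uz' zr).
Qed.

Lemma weakly_isotonic_eq x y z : U x -> U y -> U z ->
  enorm (x - y) = enorm (x - z) -> enorm (F x - F y) = enorm (F x - F z).
Proof.
by move=> Ux Uy Uz xyz; apply/eqP; rewrite eq_le !weakly_isotonic_le ?xyz.
Qed.

(* Let w i and w' i be the images of the two ends of the i-th axis, seen from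
   F m. The vectors w i - w' i are pairwise orthogonal, and w i + w' i is
   orthogonal to all of them; in dimension d it must vanish unless some
   w i - w' i does, and then F is constant on the cross. *)
Lemma weakly_isotonic_cross m r (b : 'I_d -> 'rV[R]_d) i :
    orthonormal_frame b -> U m ->
    (forall j, U (m + r *: b j)) -> (forall j, U (m - r *: b j)) ->
  F (m + r *: b i) + F (m - r *: b i) = F m + F m.
Proof.
move=> bON Um Up Un.
pose w j := F (m + r *: b j) - F m; pose w' j := F (m - r *: b j) - F m.
suff ws : w i + w' i = 0.
  by apply: subr0_eq; rewrite opprD addrACA.
have cross_sqr (p q : R) j k :
    dot (p *: b j - q *: b k) (p *: b j - q *: b k)
    = p ^+ 2 + q ^+ 2 - 2 * p * q * (j == k)%:R.
  by rewrite !dotE !bON !eqxx (eq_sym k j); case: (j == k) => /=; ring.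
have norm_eq (u v : 'rV[R]_d) : dot u u = dot v v -> enorm u = enorm v.
  by rewrite !enormE => ->.
have mD (p q : R) j k : m + p *: b j - (m + q *: b k) = p *: b j - q *: b k.
  by rewrite opprD addrACA subrr add0r.
have pE j : m - r *: b j = m + (- r) *: b j by rewrite scaleNr.
have wn j : dot (w j) (w j) = dot (w' j) (w' j).
  rewrite -!sqr_enorm /w /w' !(enormB _ (F m)); congr (_ ^+ 2).
  by apply: weakly_isotonic_eq => //; rewrite !opprD opprK !addNKr enormN.
(* [F x] and [F m] are both equidistant from [F u] and [F v], so they lie on the bisecting
   hyperplane of these two points. *)
have wd u v x : enorm (F x - F u) = enorm (F x - F v) ->
    dot (F u - F m) (F u - F m) = dot (F v - F m) (F v - F m) ->
    dot (F x - F m) (F u - F v) = 0.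
  set X := F x; set A := F u; set B := F v; set M := F m.
  move=> /(congr1 (fun t => t ^+ 2)).
  rewrite !sqr_enorm !dotE (dotC A X) (dotC B X) (dotC M A) (dotC M B); lra.
have wj j k : j != k -> dot (w j) (w k - w' k) = 0.
  move=> jk; rewrite /w /w' opprB addrA subrK; apply: wd; last exact: wn.
  apply: weakly_isotonic_eq => //; apply: norm_eq.
  by rewrite pE !mD !cross_sqr (negPf jk) /=; ring.
have w'j j k : j != k -> dot (w' j) (w k - w' k) = 0.
  move=> jk; rewrite /w /w' opprB addrA subrK; apply: wd; last exact: wn.
  apply: weakly_isotonic_eq => //; apply: norm_eq.
  by rewrite !pE !mD !cross_sqr (negPf jk) /=; ring.
have [[j wj0]|nw] := pselect (exists j, w j = w' j); last first.
  apply: (@orthogonal_family_total _ _ (fun j => w j - w' j)) => [j k jk|j|j].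
  - by rewrite dotDl dotNl wj // w'j // subrr.
  - by rewrite subr_eq0; apply/eqP => wj0; apply: nw; exists j.
  (* On the axis [i] itself the product is the difference of the squared norms of [w i] and [w' i],
     which are equal. *)
  - have [->|ij] := eqVneq i j; last by rewrite dotDl wj // w'j // addr0.
    move: (w j) (w' j) (wn j) => p q pq.
    by rewrite !dotE (dotC q p) pq; ring.
have {wj0} Fj : F (m + r *: b j) = F (m - r *: b j) by apply: (addIr (- F m)).
(* The two ends of axis [j] have the same image, so every point at most as far from one end as the
   other end is has that image too. The ends are at the largest distance occurring in the cross. *)
have const z : U z ->
    enorm (m + r *: b j - z) <= enorm (m + r *: b j - (m - r *: b j)) ->
    F z = F (m + r *: b j).
  move=> Uz /(weakly_isotonic_le (Up j) Uz (Un j)); rewrite -Fj subrr enorm0 => h.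
  by apply/esym/eqP; rewrite -subr_eq0 -enorm_eq0 eq_le h enorm_ge0.
have r2 := sqr_ge0 r.
have Fm : F m = F (m + r *: b j).
  apply: const => //; rewrite ler_enorm.
  have -> : m + r *: b j - m = r *: b j - 0 *: b j.
    by rewrite scale0r subr0 addrC addKr.
  by rewrite pE mD !cross_sqr eqxx /=; nra.
have Fp : F (m + r *: b i) = F (m + r *: b j).
  apply: const => //; rewrite ler_enorm pE !mD !cross_sqr eqxx (eq_sym j i).
  by case: (i == j) => /=; nra.
have Fn : F (m - r *: b i) = F (m + r *: b j).
  apply: const => //; rewrite ler_enorm !pE !mD !cross_sqr eqxx (eq_sym j i).
  by case: (i == j) => /=; nra.
by rewrite /w /w' Fp Fn Fm subrr addr0.
Qed.

(** [c + u] and [c + v] are the ends of one axis of a cross centred at their midpoint [m]. Both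
    [m - c] and the arms are shorter than [r / 2], so the cross stays in the ball. *)
Lemma weakly_isotonic_midpoint c r u v : 0 < r -> eball c r `<=` U ->
    enorm u < r / 2 -> enorm v < r / 2 ->
  F (c + u) + F (c + v) = F (c + 2^-1 *: (u + v)) + F (c + 2^-1 *: (u + v)).
Proof.
move=> r0 cU ur vr.
have half2 (x : 'rV[R]_d) : 2^-1 *: (x + x) = x.
  by rewrite scalerDr -scalerDl -[RHS]scale1r; congr (_ *: _); lra.
have [->|uv] := eqVneq u v; first by rewrite half2.
have [|b [i [bON]]] := @frame_direction R d (2^-1 *: (u - v)).
  by rewrite scaler_eq0 invr_eq0 pnatr_eq0 subr_eq0.
set t := enorm _ => uvb; set m := c + _ *: _.
have tr : t < r / 2.
  rewrite /t enormZ ger0_norm ?invr_ge0 // mulrC ltr_pdivrMr //.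
  by apply: le_lt_trans (ler_enormD _ _) _; rewrite enormN; lra.
have mr : enorm (m - c) < r / 2.
  rewrite /m addrC addKr enormZ ger0_norm ?invr_ge0 // mulrC ltr_pdivrMr //.
  by apply: le_lt_trans (ler_enormD _ _) _; lra.
have b1 j : enorm (b j) = 1 by rewrite enormE bON eqxx sqrtr1.
have Ut a j : `|a| <= t -> U (m + a *: b j).
  move=> at_; apply: cU; rewrite /eball /= addrAC.
  by apply: le_lt_trans (ler_enormD _ _) _; rewrite enormZ b1; lra.
have -> : c + u = m + t *: b i.
  by rewrite -uvb /m -addrA -scalerDr addrACA subrr addr0 half2.
have -> : c + v = m - t *: b i.
  by rewrite -uvb /m -addrA -scalerBr opprB (addrC v) addrACA subrr
    add0r half2.
have t0 : 0 <= t by exact: enorm_ge0.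
apply: weakly_isotonic_cross => // [|j|j].
- by rewrite -[m]addr0 -(scale0r (b i)); apply: Ut; rewrite normr0.
- by apply: Ut; rewrite ger0_norm.
- by rewrite -scaleNr; apply: Ut; rewrite normrN ger0_norm.
Qed.

(** Seen from [c], the map preserves midpoints and is bounded, hence linear; it sends vectors of
    equal length to vectors of equal length, so its matrix is a multiple of an orthogonal one. *)
Lemma weakly_isotonic_local_similarity c : U c ->
  exists S r, [/\ similarity S, 0 < r & forall v, enorm (v - c) < r -> F v = S v].
Proof.
move=> Uc; have [r r0 rU] := open_eball U_open Uc.
pose f v := F (c + v) - F c; pose s := r / 2.
have s0 : 0 < s by rewrite divr_gt0.
have Us v : enorm v < s -> U (c + v).
  by move=> vs; apply: rU; rewrite /eball /= addrC addKr (lt_trans vs) // /s; lra.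
have [|v vs|u v us vs|A fA] := @midpoint_linear R d f s (K + K) s0.
- by rewrite /f addr0 subrr.
- apply: le_trans (ler_enormD _ _) _; rewrite enormN.
  by apply: lerD; apply: F_bounded => //; exact: Us.
- have H := weakly_isotonic_midpoint r0 rU us vs.
  apply: (scalerI (a := 2)); first by rewrite pnatr_eq0.
  rewrite scalerA divff // scale1r scaler_nat mulr2n /f.
  by rewrite addrACA -H -addrACA.
have [u v uv vs|l [M [l0 MO AE]]] := radial_similarity (A := A) s0.
  have us : enorm u < s by rewrite uv.
  rewrite -!fA // /f !(enormB _ (F c)); apply: weakly_isotonic_eq => //.
  - exact: Us.
  - exact: Us.
  - by rewrite !opprD !addNKr !enormN.
exists (fun v => l *: (v *m M) + (F c - l *: (c *m M))), s; split=> //.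
  by exists l, M, (F c - l *: (c *m M)).
move=> v vs; have := fA _ vs; rewrite /f subrKC AE -scalemxAr mulmxBl scalerBr.
by move=> /eqP; rewrite subr_eq => /eqP ->; rewrite -addrA (addrC _ (F c)).
Qed.

End WeaklyIsotonic.

(** * Similarities: rigidity and gluing over a connected set *)

Section Similarities.
Context {R : realType} {d : nat}.
Implicit Types (u v p : 'rV[R]_d) (S : 'rV[R]_d -> 'rV[R]_d).

Lemma similarity_dist S : similarity S ->
  exists2 l : R, 0 <= l & forall u v, enorm (S u - S v) = l * enorm (u - v).
Proof.
move=> [l [M [b [l0 MO SE]]]]; exists l => // u v; rewrite !SE opprD addrACA.
rewrite subrr addr0 -scalerBr -mulmxBl enormZ ger0_norm // !enormE.
rewrite -!dot_mulmx trmx_mul mulmxA -(mulmxA _ M) (MO : M *m M^T = 1%:M).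
by rewrite mulmx1.
Qed.

Lemma similarity_affine S p v (t : R) : similarity S ->
  S (p + t *: (v - p)) = S p + t *: (S v - S p).
Proof.
move=> [l [M [b [_ _ SE]]]]; rewrite !SE opprD addrACA subrr addr0 -scalerBr.
rewrite -mulmxBl scalerA (mulrC t) mulmxDl -scalemxAl scalerDr scalerA.
by rewrite -!addrA (addrC b).
Qed.

(** Contracting [v] towards [p] by a factor [t] lands in the ball of agreement, and similarities
    commute with this contraction. *)
Lemma similarity_eq_near S S' p (r : R) : similarity S -> similarity S' -> 0 < r ->
  (forall v, enorm (v - p) < r -> S v = S' v) -> S =1 S'.
Proof.
move=> Ss S's r0 SS' v; pose t := r / (enorm (v - p) + 1).
have a0 : 0 < enorm (v - p) + 1 by rewrite ltr_wpDl ?enorm_ge0.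
have t0 : 0 < t by rewrite divr_gt0.
have Sp : S p = S' p by apply: SS'; rewrite subrr enorm0.
have : S (p + t *: (v - p)) = S' (p + t *: (v - p)).
  apply: SS'; rewrite addrC addKr enormZ gtr0_norm // /t mulrAC.
  by rewrite ltr_pdivrMr // ltr_pM2l // ltrDl.
rewrite !similarity_affine // Sp => /addrI/(scalerI (lt0r_neq0 t0)) /addIr.
by [].
Qed.

Lemma weakly_isotonic_similarity (U : set 'rV[R]_d) F (K : R) x0 :
    open U -> connected U -> U x0 -> weakly_isotonic U F ->
    (forall v, U v -> enorm (F v) <= K) ->
  exists2 S, similarity S & forall v, U v -> F v = S v.
Proof.
move=> Uo Uc Ux0 FU FK.
have loc := weakly_isotonic_local_similarity Uo FU FK.
have [S [r [Ss r0 FS]]] := loc _ Ux0; exists S => //.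
pose W := [set p | U p /\ exists2 s, 0 < s & forall v, enorm (v - p) < s -> F v = S v].
suff WU : W = U by move=> v; rewrite -WU => -[_ [s s0]]; apply; rewrite subrr enorm0.
have shrink (p q v : 'rV[R]_d) (s : R) : enorm (q - p) < s ->
    enorm (v - q) < s - enorm (q - p) -> enorm (v - p) < s.
  by move=> qp vq; apply: le_lt_trans (enorm_triangle q _ _) _; lra.
have Wo : open W.
  apply: eball_open => p [Up [s s0 sS]].
  have [t t0 tU] := open_eball Uo Up.
  exists (Num.min s t) => [|q]; first by rewrite lt_min s0.
  rewrite /eball /= lt_min => /andP[qs qt]; split; first exact: tU.
  exists (s - enorm (q - p)); first by rewrite subr_gt0.
  by move=> v vq; apply: sS; exact: shrink vq.
(* Near [p] the map is some similarity [S']. A point [q] of [W] close to [p] would make [S] and [S']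
   agree near [q], hence everywhere, putting [p] in [W]. *)
have UWo : open (U `\` W).
  apply: eball_open => p [Up nWp].
  have [t t0 tU] := open_eball Uo Up.
  have [S' [s [S's s0 sS']]] := loc _ Up.
  exists (Num.min s t) => [|q]; first by rewrite lt_min s0.
  rewrite /eball /= lt_min => /andP[qs qt]; split; first exact: tU.
  move=> [_ [a a0 aS]]; apply: nWp; split=> //; exists s => // v /sS' ->.
  apply/esym.
  apply: (similarity_eq_near (p := q) (r := Num.min a (s - enorm (q - p)))) => //.
    by rewrite lt_min a0 subr_gt0.
  move=> v'; rewrite lt_min => /andP[/aS <- v's]; apply: sS'; exact: shrink v's.
apply: Uc.
- by exists x0; split=> //; exists r.
- by exists W => //; apply/seteqP; split=> [p [Up Wp]|p []//]; split.
- exists (~` (U `\` W)); first exact: open_closedC.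
  apply/seteqP; split=> [p Wp|p [Up nUW]].
    by split; [case: Wp|case].
  by apply: contrapT => nWp; apply: nUW.
Qed.

End Similarities.

(** * Distances along filters and approximation by sample points *)

Section Limits.
Context {R : realType} {d : nat}.
Implicit Types (a b c : nat -> 'rV[R]_d) (v : 'rV[R]_d) (G : set_system nat).

Lemma ecvg_along_sub G G' a v : G `<=` G' -> ecvg_along G a v -> ecvg_along G' a v.
Proof. by move=> GG' av r r0; apply: GG'; exact: av. Qed.

Lemma ecvg_along_dist_lt G a b c c' A B C C' : Filter G ->
    ecvg_along G a A -> ecvg_along G b B -> ecvg_along G c C -> ecvg_along G c' C' ->
    enorm (A - B) < enorm (C - C') ->
  G [set n | enorm (a n - b n) < enorm (c n - c' n)].
Proof.
move=> GF aA bB cC c'C' lt; pose e := (enorm (C - C') - enorm (A - B)) / 4.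
have e0 : 0 < e by rewrite divr_gt0 ?subr_gt0.
apply: filterS (filterI (filterI (aA e e0) (bB e e0)) (filterI (cC e e0) (c'C' e e0))).
move=> n [[/= an bn] [/= cn c'n]].
have h1 := enorm_triangle A (a n) (b n); have h2 := enorm_triangle B A (b n).
have h3 := enorm_triangle (c n) C C'; have h4 := enorm_triangle (c' n) (c n) C'.
have h5 := enormB B (b n); have h6 := enormB C (c n).
by move: e0 an bn cn c'n; rewrite /e; lra.
Qed.

Lemma ecvg_along_dist_le G a b c c' A B C C' : ProperFilter G ->
    ecvg_along G a A -> ecvg_along G b B -> ecvg_along G c C -> ecvg_along G c' C' ->
    G [set n | enorm (a n - b n) <= enorm (c n - c' n)] ->
  enorm (A - B) <= enorm (C - C').
Proof.
move=> GF aA bB cC c'C' ab; rewrite leNgt; apply/negP => lt.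
have [n [/= h]] := filter_ex (filterI ab (ecvg_along_dist_lt _ cC c'C' aA bB lt)).
by rewrite ltNge h.
Qed.

Lemma ecvg_along_le G a A (K : R) : ProperFilter G -> ecvg_along G a A ->
  G [set n | enorm (a n) <= K] -> enorm A <= K.
Proof.
move=> GF aA aK; apply/ler_addgt0Pr => e e0.
have [n [/= an nK]] := filter_ex (filterI (aA e e0) aK).
by have := enorm_triangle (a n) A 0; rewrite !subr0 (enormB A); lra.
Qed.

(** [p n] is a point of the sample nearest to [z]: once the sample contains a point within [r] of
    [z], so is [p n]. The sample of size 0 is empty, hence the restriction to positive [n]. *)
Lemma sample_approx (x : nat -> 'rV[R]_d) z : closure (range x) z ->
  exists2 p, (forall n, (0 < n)%N -> sample x n (p n)) & ecvg_along \oo p z.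
Proof.
move=> xz.
have near_pt n : exists v, (0 < n)%N ->
    sample x n v /\ forall i, (i < n)%N -> enorm (v - z) <= enorm (x i - z).
  case: n => [|n]; first by exists z.
  case: (@arg_minP _ _ _ (@ord0 n) predT (fun i => enorm (x i - z))) => // i _ imin.
  exists (x i) => _; split; first by exists i => //; exact: ltn_ord.
  by move=> j jn; apply: (imin (Ordinal jn)).
have [p pP] := choice near_pt; exists p => [n /pP[]//|r r0].
have [_ [k _ <-] kr] := closure_eball xz r0.
exists k.+1 => // n /= kn; have [_ pn] := pP n (leq_ltn_trans (leq0n k) kn).
exact: le_lt_trans (pn _ kn) kr.
Qed.

End Limits.

(** At index [n], take a witness for the highest attainable level up to [n]; by monotonicity it
    serves all lower levels. *)
Lemma diagonal_choice (T : Type) (t0 : T) (P : nat -> nat -> T -> Prop) :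
    (forall m n s, P m.+1 n s -> P m n s) ->
    (forall m, exists N, forall n, (N <= n)%N -> exists s, P m n s) ->
  exists s, forall m, exists N, forall n, (N <= n)%N -> P m n (s n).
Proof.
move=> Pmon Pex.
have best n k : exists s, forall m, (m <= k)%N -> (exists s', P m n s') -> P m n s.
  elim: k => [|k [s sP]].
    have [[s Ps]|nP] := pselect (exists s, P 0%N n s).
      by exists s => m; rewrite leqn0 => /eqP ->.
    by exists t0 => m; rewrite leqn0 => /eqP ->.
  have [[s' Ps']|nP] := pselect (exists s, P k.+1 n s); last first.
    by exists s => m; rewrite leq_eqVlt => /predU1P[->//|]; exact: sP.
  (* Descend from level [k.+1] to [m] one level at a time; past level 0 the truncated difference no
     longer changes. *)
  exists s' => m mk _; rewrite -(subKn mk); elim: (k.+1 - m)%N => [|j IHj].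
    by rewrite subn0.
  have [kj|jk] := leqP k.+1 j.
    by move: IHj kj; rewrite -subn_eq0 subnS => IHj /eqP kj; rewrite kj in IHj *.
  by apply: Pmon; rewrite subnS prednK // subn_gt0.
have [s sP] := choice (fun n => best n n).
exists s => m; have [N PN] := Pex m; exists (maxn N m) => n.
by rewrite geq_max => /andP[Nn mn]; apply: sP => //; exact: PN.
Qed.

(** * Balls contained in an open set *)

Section BallCore.
Context {R : realType} {d : nat}.
Implicit Types (U : set 'rV[R]_d) (h e : R).

(** The homothety with centre [p] and ratio [h' / h] maps the given ball to one of radius [h']
    inside it that still contains [p]. *)
Lemma ball_core_le U h h' : 0 < h' -> h' <= h -> ball_core U h `<=` ball_core U h'.
Proof.
move=> h'0 h'h p [Up [y [Uy py yU]]]; split=> //.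
have h0 : 0 < h by exact: lt_le_trans h'h.
pose t := h' / h; have t0 : 0 < t by rewrite divr_gt0.
have t1 : t <= 1 by rewrite ler_pdivrMr // mul1r.
have th : t * h = h' by rewrite divfK // gt_eqF.
have {}py : enorm (p - y) < h := py.
pose y' := y + (1 - t) *: (p - y).
have y'y : enorm (y' - y) = (1 - t) * enorm (p - y).
  by rewrite /y' addrC addKr enormZ ger0_norm // subr_ge0.
have sub : eball y' h' `<=` U.
  move=> q; rewrite /eball /= => qy'; apply: yU; rewrite /eball /=.
  apply: le_lt_trans (enorm_triangle y' _ _) _; rewrite y'y.
  by move: (enorm_ge0 (p - y)); nra.
exists y'; split=> //.
  by apply: sub; rewrite /eball /= subrr enorm0.
rewrite /eball /=.
have -> : p - y' = t *: (p - y).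
  by rewrite /y' scalerBl scale1r opprD opprB addrA addrCA subrr addr0.
by rewrite enormZ gtr0_norm // -th ltr_pM2l.
Qed.

(* z may lie on the boundary of U. *)
Lemma ball_boundary_pair U y z h e (i : 'I_d) : 0 < h -> eball y h `<=` U ->
    enorm (z - y) <= h -> 0 < e ->
  exists p u, [/\ U p, U u, enorm (p - z) < enorm (p - u) & enorm (p - u) < e].
Proof.
move=> h0 yU zy e0.
(* A unit direction making no acute angle with [z - y], so that a short step along it from [p] stays
   in the ball. *)
have [b [b1 bz]] : exists b : 'rV[R]_d, dot b b = 1 /\ dot b (z - y) <= 0.
  pose b : 'rV[R]_d := delta_mx 0 i.
  have b1 : dot b b = 1 by rewrite delta_frame eqxx.
  have [bz|/ltW bz] := leP (dot b (z - y)) 0; first by exists b.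
  by exists (- b); rewrite dotNl dotNr opprK dotNl oppr_le0.
(* This choice gives both [2 * t * h < e] and [t < 1/4]. The latter yields
   [(1 - t)^2 + 4 * t^2 < 1], which keeps [u] in the ball, while [p] is within [t * h] of [z] and
   exactly [2 * t * h] from [u]. *)
pose t := e / (4 * e + 3 * h).
have D0 : 0 < 4 * e + 3 * h by rewrite addr_gt0 ?mulr_gt0.
have t0 : 0 < t by rewrite divr_gt0.
have t4 : t < 4^-1 by rewrite ltr_pdivrMr //; lra.
have te : 2 * t * h < e.
  have -> : 2 * t * h = 2 * e * h / (4 * e + 3 * h) by rewrite /t; field; rewrite gt_eqF.
  by rewrite ltr_pdivrMr //; nra.
pose p := z + t *: (y - z); pose u := p + (2 * t * h) *: b.
have pz : enorm (p - z) = t * enorm (z - y).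
  by rewrite /p addrC addKr enormZ gtr0_norm // enormB.
have pu : enorm (p - u) = 2 * t * h.
  rewrite /u opprD addNKr enormN enormZ enormE b1 sqrtr1 mulr1.
  by apply: gtr0_norm; apply: mulr_gt0 => //; exact: mulr_gt0.
have py : p - y = (1 - t) *: (z - y).
  by rewrite /p scalerBl scale1r -scalerN opprB addrAC.
have w0 := enorm_ge0 (z - y).
have lt_enorm_h (w : 'rV[R]_d) : dot w w < h ^+ 2 -> enorm w < h.
  rewrite -sqr_enorm => hw; rewrite -(@ltr_pXn2r _ 2) ?nnegrE ?enorm_ge0 ?(ltW h0) //.
exists p, u; split.
- apply: yU; rewrite /eball /= py enormZ gtr0_norm; first by nra.
  lra.
- apply: yU; rewrite /eball /= /u addrAC py; apply: lt_enorm_h.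
  move: (z - y) bz w0 zy => w bz w0 zy.
  rewrite !dotE b1 (dotC w b) -sqr_enorm.
  have w2 : enorm w ^+ 2 <= h ^+ 2 by rewrite ler_pXn2r ?nnegrE // ltW.
  have tb : t * h * (1 - t) * dot b w <= 0.
    apply: mulr_ge0_le0 => //; apply: mulr_ge0; last by lra.
    exact: ltW (mulr_gt0 t0 h0).
  have h2 : 0 < h ^+ 2 by rewrite exprn_gt0.
  have t2 : (1 - t) ^+ 2 * enorm w ^+ 2 <= (1 - t) ^+ 2 * h ^+ 2.
    by rewrite ler_wpM2l ?sqr_ge0.
  have : (1 - t) ^+ 2 * h ^+ 2 + 4 * t ^+ 2 * h ^+ 2 < h ^+ 2.
    have : 0 < t * (2 - 5 * t) * h ^+ 2.
      by apply: mulr_gt0 => //; apply: mulr_gt0 => //; lra.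
    lra.
  lra.
- by rewrite pz pu; have := ler_wpM2l (ltW t0) zy; have := mulr_gt0 t0 h0; lra.
- by rewrite pu.
Qed.

End BallCore.

(** * Convergence on samples *)

Section Sampling.
Context {R : realType} {d : nat}.
Variables (U : set 'rV[R]_d) (x : nat -> 'rV[R]_d).
Variables (phi : nat -> 'rV[R]_d -> 'rV[R]_d) (K : R).
Hypotheses (U_open : open U) (U_connected : connected U) (U_bounded : bounded_set U).
Hypothesis x_in_U : forall n, U (x n).
Hypothesis x_dense : U `<=` closure (range x).
Hypothesis phi_bounded : forall n v, sample x n v -> enorm (phi n v) <= K.
Hypothesis phi_weak : forall n, weakly_isotonic (sample x n) (phi n).
Implicit Types (G : set_system nat) (S : 'rV[R]_d -> 'rV[R]_d) (V : set 'rV[R]_d).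

(** One approximating sequence per point is enough: limits are compared through the values of
    [phi n] on these sequences. *)
Definition sampled_limit G S := forall z, U z -> exists p,
  [/\ G [set n | sample x n (p n)], ecvg_along G p z &
      ecvg_along G (fun n => phi n (p n)) (S z)].

Lemma sampled_limit_similarity G : UltraFilter G -> \oo `<=` G ->
  exists2 S, similarity S & sampled_limit G S.
Proof.
move=> GU ooG; have GP : ProperFilter G := @ultra_proper _ _ GU.
have F_ex z : exists w, U z -> exists p,
    [/\ G [set n | sample x n (p n)], ecvg_along G p z &
        ecvg_along G (fun n => phi n (p n)) w].
  have [Uz|nUz] := pselect (U z); last by exists z.
  have [p ps pz] := sample_approx (x_dense Uz).
  have Gp : G [set n | sample x n (p n)] by apply: ooG; exists 1%N => // n; exact: ps.
  have [w pw] : exists w, ecvg_along G (fun n => phi n (p n)) w.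
    by apply: (@ultra_bounded_ecvg _ _ _ _ K); apply: filterS Gp => n; exact: phi_bounded.
  by exists w => _; exists p; split=> //; exact: ecvg_along_sub pz.
have [F FP] := choice F_ex.
have [||S Ss FS] :=
  @weakly_isotonic_similarity R d U F K (x 0) U_open U_connected (x_in_U 0).
(* A strict inequality between limit distances holds for the approximants along [G]; the weak
   inequality between their images passes to the limit. *)
- move=> u v w Uu Uv Uw uvw.
  have [p [ps pu pF]] := FP _ Uu; have [q [qs qv qF]] := FP _ Uv.
  have [r [rs rw rF]] := FP _ Uw.
  apply: (ecvg_along_dist_le GP pF qF pF rF).
  apply: filterS (filterI (filterI ps qs)
    (filterI rs (ecvg_along_dist_lt GP pu qv pu rw uvw))) => n [[np nq] [nr lt]].
  exact: (phi_weak np nq nr lt).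
- move=> v /FP[p [ps _ pF]]; apply: (ecvg_along_le GP pF).
  by apply: filterS ps => n; exact: phi_bounded.
by exists S => // z Uz; rewrite -FS //; exact: FP.
Qed.

(** Badness of an index concerns every similarity, so it applies to the [S] built afterwards from
    the ultrafilter of bad indices. This yields points [p n] with error above [e]; compactness gives
    [z] and [w], and [w = S z] would make the error small since [S] is Lipschitz. *)
Lemma bad_sample_limit V e : 0 < e ->
    ~ (exists N, forall n, (N <= n)%N -> exists2 S, similarity S &
         forall i, (i < n)%N -> V (x i) -> enorm (phi n (x i) - S (x i)) <= e) ->
  exists G S p z w,
    [/\ UltraFilter G, similarity S /\ sampled_limit G S,
        G [set n | sample x n (p n) /\ V (p n)], ecvg_along G p z &
        ecvg_along G (fun n => phi n (p n)) w /\ w <> S z].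
Proof.
move=> e0 notV.
have [|G [GU ooG Gbad]] := @ultra_infty_ex [set n | ~ exists2 S, similarity S &
    forall i, (i < n)%N -> V (x i) -> enorm (phi n (x i) - S (x i)) <= e].
  move=> N; apply: contrapT => nN; apply: notV; exists N => n Nn.
  by apply: contrapT => nS; apply: nN; exists n.
have [S Ss SG] := sampled_limit_similarity GU ooG.
have p_ex n : exists p, (~ exists2 S, similarity S &
    forall i, (i < n)%N -> V (x i) -> enorm (phi n (x i) - S (x i)) <= e) ->
    [/\ sample x n p, V p & e < enorm (phi n p - S p)].
  have [[i [ni Vi ei]]|nex] := pselect (exists i,
      [/\ (i < n)%N, V (x i) & e < enorm (phi n (x i) - S (x i))]).
    by exists (x i) => _; split=> //; exists i.
  exists 0; case; exists S => // i ni Vi; rewrite leNgt; apply/negP => ei.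
  by apply: nex; exists i.
have [p pP] := choice p_ex.
have {}pP : G [set n |
    [/\ sample x n (p n), V (p n) & e < enorm (phi n (p n) - S (p n))]].
  by apply: filterS Gbad => n; exact: pP.
have [KU KUP] := bounded_enorm U_bounded.
have [z pz] : exists z, ecvg_along G p z.
  apply: (@ultra_bounded_ecvg _ _ _ _ KU); apply: filterS pP => n [[i _ pi] _ _].
  by rewrite /= -pi; apply: KUP.
have [w pw] : exists w, ecvg_along G (fun n => phi n (p n)) w.
  apply: (@ultra_bounded_ecvg _ _ _ _ K); apply: filterS pP => n [ns _ _].
  exact: phi_bounded.
exists G, S, p, z, w; split=> //.
  by apply: filterS pP => n [].
split=> // wS; have [l l0 SE] := similarity_dist Ss.
have l1 : 0 < l + 1 by rewrite ltr_wpDl.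
have e2 : 0 < e / 2 by rewrite divr_gt0.
have e3 : 0 < e / 2 / (l + 1) by rewrite divr_gt0.
have [n [[/= nz nw] [_ _ en]]] :=
  filter_ex (filterI (filterI (pz _ e3) (pw _ e2)) pP).
have : enorm (S (p n) - w) <= e / 2.
  rewrite wS SE; move: nz; rewrite ltr_pdivlMr // => nz.
  by have := enorm_ge0 (p n - z); nra.
have := enorm_triangle w (phi n (p n)) (S (p n)); rewrite (enormB w (S (p n))).
by move: en nw; lra.
Qed.

(** If [S] has ratio [l], both [S y - S z] and [S y - w] have norm at most [l * e]. *)
Lemma similarity_limit_eq S z w : similarity S ->
    (forall e, 0 < e -> exists y, enorm (y - z) < e /\
      exists u v, enorm (u - v) < e /\ enorm (S y - w) <= enorm (S u - S v)) ->
  w = S z.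
Proof.
move=> /similarity_dist[l l0 SE] Hw; apply/eqP; rewrite -subr_eq0 -enorm_eq0.
rewrite eq_le enorm_ge0 andbT; apply/ler_addgt0Pr => e e0; rewrite add0r.
have l1 : 0 < 2 * (l + 1) by rewrite mulr_gt0 // ltr_wpDl.
have [|y [yz [u [v [uv yw]]]]] := Hw (e / (2 * (l + 1))); first by rewrite divr_gt0.
move: yz uv yw; rewrite !ltr_pdivlMr // SE => yz uv yw.
have := enorm_triangle (S y) w (S z); rewrite (enormB w (S y)) SE.
have := enorm_ge0 (y - z); have := enorm_ge0 (u - v); nra.
Qed.

Lemma weak_convergence h e : 0 < h -> 0 < e ->
  exists N, forall n, (N <= n)%N -> exists2 S, similarity S &
    forall i, (i < n)%N -> ball_core U h (x i) -> enorm (phi n (x i) - S (x i)) <= e.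
Proof.
move=> h0 e0; apply: contrapT => /(bad_sample_limit e0).
move=> [G [S [p [z [w [GU [Ss SG] Gp pz [pw wS]]]]]]]; apply: wS.
have GP : ProperFilter G := @ultra_proper _ _ GU.
(* In dimension 0 all vectors coincide; otherwise [i] supplies a direction. *)
have [[i _]|noi] := pselect (exists i : 'I_d, True); last first.
  by apply/rowP => i; case: noi; exists i.
(* The centres of the balls witnessing [ball_core] also converge along [G], to some [y]; the limit
   ball lies in [U] and its closed ball contains [z]. *)
have c_ex n : exists c, ball_core U h (p n) ->
    [/\ U c, enorm (p n - c) < h & eball c h `<=` U].
  have [[_ [c [Uc pc cU]]]|nc] := pselect (ball_core U h (p n)); last by exists z.
  by exists c.
have [c cP] := choice c_ex.
have {}cP : G [set n | [/\ U (c n), enorm (p n - c n) < h & eball (c n) h `<=` U]].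
  by apply: filterS Gp => n [_]; exact: cP.
have [KU KUP] := bounded_enorm U_bounded.
have [y cy] : exists y, ecvg_along G c y.
  apply: (@ultra_bounded_ecvg _ _ _ _ KU); apply: filterS cP => n [Uc _ _].
  exact: KUP.
have zy : enorm (z - y) <= h.
  apply/ler_addgt0Pr => a a0; have a2 : 0 < a / 2 by rewrite divr_gt0.
  have [n [[/= nz ny] [_ pc _]]] :=
    filter_ex (filterI (filterI (pz _ a2) (cy _ a2)) cP).
  have := enorm_triangle (p n) z y; have := enorm_triangle (c n) (p n) y.
  by rewrite (enormB z (p n)); lra.
have yU : eball y h `<=` U.
  move=> q; rewrite /eball /= => qy.
  have a0 : 0 < h - enorm (q - y) by rewrite subr_gt0.
  have [n [/= ny [_ _ cU]]] := filter_ex (filterI (cy _ a0) cP).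
  apply: cU; rewrite /eball /=; apply: le_lt_trans (enorm_triangle y _ _) _.
  by rewrite (enormB y); lra.
apply: (similarity_limit_eq Ss) => a a0.
have [q [u [Uq Uu qzu qua]]] := ball_boundary_pair i h0 yU zy a0.
exists q; split; first exact: lt_trans qua.
exists q, u; split=> //.
have [q' [q's q'q q'S]] := SG _ Uq; have [u' [u's u'u u'S]] := SG _ Uu.
apply: (ecvg_along_dist_le GP q'S pw q'S u'S).
apply: filterS (filterI (filterI q's u's) 
  (filterI Gp (ecvg_along_dist_lt GP q'q pz q'q u'u qzu))) =>
  n [[nq nu] [[np _] lt]].
exact: (phi_weak nq np nu lt).
Qed.

Lemma isotonic_convergence e : (forall n, isotonic (sample x n) (phi n)) -> 0 < e ->
  exists N, forall n, (N <= n)%N -> exists2 S, similarity S &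
    forall i, (i < n)%N -> [set: 'rV[R]_d] (x i) -> enorm (phi n (x i) - S (x i)) <= e.
Proof.
move=> phi_iso e0; apply: contrapT => /(bad_sample_limit e0).
move=> [G [S [p [z [w [GU [Ss SG] Gp pz [pw wS]]]]]]]; apply: wS.
have GP : ProperFilter G := @ultra_proper _ _ GU.
have [[i _]|noi] := pselect (exists i : 'I_d, True); last first.
  by apply/rowP => i; case: noi; exists i.
apply: (similarity_limit_eq Ss) => a a0.
have [r r0 rU] := open_eball U_open (x_in_U 0).
(* The pair [v], [x 0] is a yardstick of length [s < a], placed anywhere in [U]: isotonicity lets it
   be compared with distances near [z]. *)
pose s := Num.min (r / 2) (a / 2); pose v := x 0 + s *: delta_mx 0 i.
have s0 : 0 < s by rewrite lt_min !divr_gt0.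
have vx : enorm (v - x 0) = s.
  by rewrite /v addrC addKr enormZ enormE delta_frame eqxx sqrtr1 mulr1 gtr0_norm.
have sr : s < r by rewrite gt_min; apply/orP; left; lra.
have sa : s < a by rewrite gt_min; apply/orP; right; lra.
have Uv : U v by apply: rU; rewrite /eball /= vx.
(* One fixed [p n] serves as the point of [U] near [z]; the limit is then taken over a separate
   index. *)
have [n [/= nz [[k kn pk] _]]] := filter_ex (filterI (pz _ s0) Gp).
have Uy : U (p n) by rewrite -pk; exact: x_in_U.
exists (p n); split; first exact: lt_trans sa.
exists v, (x 0); split; first by rewrite vx.
have [y' [y's y'y y'S]] := SG _ Uy; have [v' [v's v'v v'S]] := SG _ Uv.
have [u' [u's u'u u'S]] := SG _ (x_in_U 0).
apply: (ecvg_along_dist_le GP y'S pw v'S u'S).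
rewrite -vx in nz.
apply: filterS (filterI (filterI y's (filterI u's v's)) 
  (filterI Gp (ecvg_along_dist_lt GP y'y pz v'v u'u nz))) =>
  m [[my [mu mv]] [[mp _] lt]].
exact: (phi_iso _ _ _ _ _ my mp mv mu lt).
Qed.

Lemma similarity_sequence (V : nat -> set 'rV[R]_d) :
    (forall m, V m `<=` V m.+1) ->
    (forall m e, 0 < e -> exists N, forall n, (N <= n)%N -> exists2 S, similarity S &
      forall i, (i < n)%N -> V m (x i) -> enorm (phi n (x i) - S (x i)) <= e) ->
  exists S : nat -> 'rV[R]_d -> 'rV[R]_d, (forall n, similarity (S n)) /\
    forall m (A : set 'rV[R]_d), A `<=` V m ->
      (fun n => max_error x n A (phi n) (S n)) @ \oo --> (0 : R).
Proof.
move=> Vmon VS.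
have id_sim : similarity (@id 'rV[R]_d).
  exists 1, 1%:M, 0; split=> //; first by rewrite /orthogonal_matrix trmx1 mulmx1.
  by move=> v; rewrite mulmx1 scale1r addr0.
(* Choosing in the subtype makes every term a similarity, including the early terms where no
   estimate holds. *)
pose T := {S : 'rV[R]_d -> 'rV[R]_d | similarity S}.
have [|m|S SP] := @diagonal_choice T (exist _ _ id_sim) (fun m n s =>
    forall i, (i < n)%N -> V m (x i) ->
      enorm (phi n (x i) - sval s (x i)) <= m.+1%:R^-1).
- move=> m n S SP i ni Vi; apply: le_trans (SP i ni (Vmon _ _ Vi)) _.
  by rewrite lef_pV2 ?posrE // ler_nat.
- have [|N NP] := VS m m.+1%:R^-1; first by rewrite invr_gt0.
  by exists N => n /NP[S Ss SP]; exists (exist _ _ Ss).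
exists (fun n => sval (S n)); split=> [n|m A AV]; first exact: svalP.
apply/cvgr0Pnorm_le => e e0.
have [M _ MP] := near_infty_natSinv_lt (PosNum e0).
(* Level [maxn m M] is high enough both for the set [V m] and for the tolerance [e]. *)
have [N NP] := SP (maxn m M); exists N => // n /= Nn.
rewrite ger0_norm ?bigmax_ge_id //; apply: bigmax_le => [|i]; first exact: ltW.
rewrite inE => /AV Vi; apply: le_trans (NP n Nn i (ltn_ord i) _) _; last first.
  exact: ltW (MP _ (leq_maxr m M)).
rewrite -(subnKC (leq_maxl m M)).
by elim: (_ - _)%N => [|j /Vmon]; rewrite ?addn0 ?addnS.
Qed.

End Sampling.

Theorem theorem2 (R : realType) (d : nat) (U : set 'rV[R]_d)
    (U_bounded : bounded_set U) (U_connected : connected U) (U_open : open U)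
    (x : nat -> 'rV[R]_d) (x_in_U : forall n, U (x n))
    (x_dense : U `<=` closure (range x))
    (Q : set 'rV[R]_d) (Q_bounded : bounded_set Q)
    (phi : nat -> 'rV[R]_d -> 'rV[R]_d)
    (phi_in_Q : forall n v, sample x n v -> Q (phi n v))
    (phi_weakly_isotonic : forall n, weakly_isotonic (sample x n) (phi n)) :
  (exists S : nat -> 'rV[R]_d -> 'rV[R]_d,
     (forall n, similarity (S n)) /\
     forall h : R, 0 < h ->
       (fun n => max_error x n (ball_core U h) (phi n) (S n)) @ \oo --> (0 : R))
  /\
  ((forall n, isotonic (sample x n) (phi n)) ->
   exists S : nat -> 'rV[R]_d -> 'rV[R]_d,
     (forall n, similarity (S n)) /\
     (fun n => max_error x n setT (phi n) (S n)) @ \oo --> (0 : R)).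
Proof.
have [K QK] := bounded_enorm Q_bounded.
have phiK n v (nv : sample x n v) := QK _ (phi_in_Q n v nv).
split=> [|phi_isotonic].
  (* [ball_core U h] grows as [h] decreases, so the radii [1 / (m + 1)] cover every [h > 0]. *)
  have [m|m e e0|S [Ss SV]] :=
      @similarity_sequence R d x phi (fun m => ball_core U m.+1%:R^-1).
  - by apply: ball_core_le; rewrite ?invr_gt0 // lef_pV2 ?posrE // ler_nat.
  - by apply: (weak_convergence U_open U_connected U_bounded x_in_U x_dense phiK);
      rewrite ?invr_gt0.
  exists S; split=> // h h0.
  have [M _ MP] := near_infty_natSinv_lt (PosNum h0).
  apply: (SV M); apply: ball_core_le; rewrite ?invr_gt0 //.
  exact: ltW (MP _ (leqnn M)).
have [//|m e e0|S [Ss SV]] := @similarity_sequence R d x phi (fun=> setT).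
  exact: (isotonic_convergence U_open U_connected U_bounded x_in_U x_dense phiK).
by exists S; split=> //; exact: (SV 0).
Qed.
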